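(* For $1\le k\le n\le 5k$ the following congruences hold modulo $5$: if $n-k$ is even, $r(n,k)\equiv \frac{(2n)!}{\left(\frac{5k-n}{2}\right)!\left(\frac{n-k}{2}\right)!\,5^{\frac{n-k}{2}}}$; if $n-k$ is odd, $r(n,k)\equiv \frac{2\,(2n)!}{\left(\frac{5k-n-1}{2}\right)!\left(\frac{n-k-1}{2}\right)!\,5^{\frac{n-k-1}{2}}}$ (the right-hand sides being integers). If $1\le k$ and $n>5k$, then $r(n,k)\equiv 0 \pmod 5$.
   Context: Define the integer sequence $u$ by $u(0)=1$ and, for $n\ge 1$, $u(n)=\Big(\prod_{j=1}^{n}(4j-1)\Big)^2-\sum_{m=0}^{n-1}\binom{2n+1}{2m+1}\Big(\prod_{j=1}^{n-m}(4j-3)\Big)^2u(m)$. For $1\le k\le n$ define $s(n,k)=\frac{(2n)!}{(2k)!}[z^{2n}]\Big(\sum_{j=0}^\infty \frac{u(j)}{(2j+1)!}z^{2j+1}\Big)^{2k}$ (coefficient of $z^{2n}$) and $r(n,k)=2^{n-k}s(n,k)$; these are integers. *)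

(* Defs.v *)
From mathcomp Require Import all_boot all_order all_algebra.
Set Implicit Arguments.
Unset Strict Implicit.
Unset Printing Implicit Defensive.
Import Order.TTheory GRing.Theory Num.Theory.
Local Open Scope ring_scope.

(* The right-hand side of the recurrence for u at index n, where us lists
   u(0), ..., u(n-1). For n = 0 it is the squared empty product, i.e. 1. *)
Definition u_rec (us : seq int) (n : nat) : int :=
  (\prod_(1 <= j < n.+1) (4 * j%:Z - 1)) ^+ 2
  - \sum_(m < n) 'C((2 * n).+1, (2 * m).+1)%:Z
      * (\prod_(1 <= j < (n - m).+1) (4 * j%:Z - 3)) ^+ 2 * us`_m.

(* u_prefix n = [:: u(0); ...; u(n-1)]. *)
Fixpoint u_prefix (n : nat) : seq int :=
  if n is n'.+1 then rcons (u_prefix n') (u_rec (u_prefix n') n') else [::].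

Definition u (n : nat) : int := u_rec (u_prefix n) n.

Lemma size_u_prefix n : size (u_prefix n) = n.
Proof. by elim: n => //= n IHn; rewrite size_rcons IHn. Qed.

Lemma nth_u_prefix n m : (m < n)%N -> (u_prefix n)`_m = u m.
Proof.
elim: n => // n IHn; rewrite ltnS leq_eqVlt /= nth_rcons size_u_prefix.
by case/predU1P=> [->|lt_mn]; rewrite ?ltnn ?eqxx // lt_mn IHn.
Qed.

Lemma u0 : u 0 = 1.
Proof. by rewrite /u /u_rec big_ord0 big_geq // subr0 expr1n. Qed.

Lemma uE n : (1 <= n)%N ->
  u n = (\prod_(1 <= j < n.+1) (4 * j%:Z - 1)) ^+ 2
        - \sum_(m < n) 'C((2 * n).+1, (2 * m).+1)%:Z
            * (\prod_(1 <= j < (n - m).+1) (4 * j%:Z - 3)) ^+ 2 * u m.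
Proof.
move=> _; rewrite {1}/u /u_rec; congr (_ - _).
by apply: eq_bigr => m _; rewrite nth_u_prefix.
Qed.

(* Formal power series over rat, as coefficient sequences. *)
Definition fps := nat -> rat.

Definition fps_one : fps := fun i => (i == 0%N)%:R.

Definition fps_mul (f g : fps) : fps :=
  fun n => \sum_(i < n.+1) f i * g (n - i)%N.

Definition fps_exp (f : fps) (k : nat) : fps := iter k (fps_mul f) fps_one.

(* \sum_(j >= 0) u(j) / (2j+1)! z^(2j+1) *)
Definition u_egf : fps :=
  fun i => if odd i then (u i./2)%:~R / (i`!)%:R else 0.

Definition s (n k : nat) : rat :=
  ((2 * n)`!)%:R / ((2 * k)`!)%:R * fps_exp u_egf (2 * k)%N (2 * n)%N.

Definition r (n k : nat) : rat := 2 ^+ (n - k) * s n k.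

(* x and y are both integers, and they are congruent modulo d. *)
Definition int_congr (d : int) (x y : rat) : Prop :=
  exists a b : int, [/\ x = a%:~R, y = b%:~R & (a = b %[mod d])%Z].

(* Main.v *)
(* Let B_{N,K} be the partial exponential Bell polynomials, which have integer
   coefficients. Then s(n,k) = B_{2n,2k}(x) with x_{2j+1} = u(j) and x_{2j} = 0, so
   modulo 5 only the residues of u matter. In the recurrence for u all products
   of factors 4j-3 with at least two factors and all products of factors 4j-1
   with at least four factors vanish modulo 5; hence u = 1, 1, 1, 0, 0, ...
   Thus s(n,k) is congruent to the number of partitions of a 2n-set into 2k
   blocks of sizes 1, 3 and 5. Those with b blocks of size 3 are counted by a
   multiple of (3b)!/(b! 6^b), which is divisible by 5 for b >= 2. The parity of
   n - k selects b = 0 or b = 1, and a single term survives. *)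
Require Import Defs.
From mathcomp Require Import all_boot all_order all_algebra.
From mathcomp Require Import ring zify.
Import Order.TTheory GRing.Theory Num.Theory.
Local Open Scope ring_scope.

(** * Bell polynomials and powers of exponential generating functions *)

(* [bell x K N] is B_{N,K}(x_1, x_2, ...), by recursion on the block of a fixed
   element; [x 0] is never used. *)
Fixpoint bell (x : nat -> int) (K N : nat) : int :=
  match K, N with
  | 0, _ => (N == 0%N)%:R
  | K'.+1, 0 => 0
  | K'.+1, M.+1 => \sum_(j < M.+1) 'C(M, j)%:R * x j.+1 * bell x K' (M - j)
  end.

Lemma natf_fact_neq0 n : (n`!)%:R != 0 :> rat.
Proof. by rewrite pnatr_eq0 -lt0n fact_gt0. Qed.

(** Comparing coefficients of z^M in (P^(K+1))' = (K+1) P' P^K gives the recursion of [bell].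
    Agreement below degree [L] suffices, so a truncation can replace a power series. *)
Lemma bell_coef (x : nat -> int) (P : {poly rat}) (L : nat) :
    x 0%N = 0 ->
    (forall i, (i < L)%N -> P`_i = (x i)%:~R / (i`!)%:R) ->
  forall K N, (N < L)%N ->
    (N`!)%:R / (K`!)%:R * (P ^+ K)`_N = (bell x K N)%:~R.
Proof.
move=> x0 PE; elim=> [|K IHK] [|M] ltNL.
- by rewrite expr0 coef1 /= !fact0 divr1 !mulr1.
- by rewrite expr0 coef1 mulr0.
- by rewrite exprS coefM big_ord1 PE // x0 !mul0r mulr0.
have /(congr1 (fun q : {poly rat} => q`_M)) := deriv_exp P K.+1.
rewrite coef_deriv coefMn coefM /= => dE.
have -> : (M.+1`!)%:R / (K.+1`!)%:R * (P ^+ K.+1)`_M.+1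
    = (M`!)%:R / (K.+1`!)%:R * ((P ^+ K.+1)`_M.+1 *+ M.+1).
  by rewrite factS natrM -mulr_natr; ring.
rewrite dE rmorph_sum /= factS natrM.
have -> : (M`!)%:R / (K.+1%:R * (K`!)%:R)
    * ((\sum_(j < M.+1) P^`()`_j * (P ^+ K)`_(M - j)) *+ K.+1)
    = (M`!)%:R / (K`!)%:R * (\sum_(j < M.+1) P^`()`_j * (P ^+ K)`_(M - j)).
  rewrite -mulr_natr; field.
  by rewrite natf_fact_neq0 nat1r pnatr_eq0.
rewrite mulr_sumr; apply: eq_bigr => j _.
have lejM : (j <= M)%N by rewrite -ltnS.
rewrite coef_deriv PE ?(leq_ltn_trans _ ltNL) // !rmorphM /= -IHK; last by lia.
rewrite -(bin_fact lejM) -mulr_natr factS !natrM /= pmulrn.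
field.
by rewrite !natf_fact_neq0 nat1r pnatr_eq0.
Qed.

Lemma bell_congr (R : pzRingType) (x y : nat -> int) :
    (forall i, (x i)%:~R = (y i)%:~R :> R) ->
  forall K N, (bell x K N)%:~R = (bell y K N)%:~R :> R.
Proof.
move=> xy; elim=> [|K IHK] [|M] //=.
by rewrite !rmorph_sum; apply: eq_bigr => j _; rewrite !rmorphM /= xy IHK.
Qed.

Lemma fps_exp_coef (f : fps) (L K N : nat) : (N < L)%N ->
  fps_exp f K N = ((\poly_(i < L) f i) ^+ K)`_N.
Proof.
elim: K N => [|K IHK] N ltNL; first by rewrite expr0 coef1.
rewrite exprS coefM /=; apply: eq_bigr => i _.
have leiN : (i <= N)%N by rewrite -ltnS.
rewrite coef_poly (leq_ltn_trans leiN ltNL) -IHK //.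
exact: leq_ltn_trans (leq_subr _ _) ltNL.
Qed.

Lemma eqz_mod5 (a b : int) :
  a%:~R = b%:~R :> 'F_5 -> (a = b %[mod 5])%Z.
Proof.
move=> ab; apply/eqP; rewrite eqz_mod_dvd (@dvdz_pcharf 'F_5) ?pchar_Fp //.
by rewrite rmorphB /= ab subrr.
Qed.

(** * The sequence u modulo 5 *)

Definition ind135 (i : nat) : int := (i \in [:: 1; 3; 5]%N)%:R.

Definition u_coef (i : nat) : int := if odd i then u i./2 else 0.

Lemma u_mod5S n : (u n.+1)%:~R =
  ((\prod_(1 <= j < n.+2) (4 * j%:Z - 1)) ^+ 2)%:~R
  - 'C((2 * n.+1).+1, 2)%:R * (u n)%:~R :> 'F_5.
Proof.
rewrite uE // rmorphB /=; congr (_ - _).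
rewrite rmorph_sum big_ord_recr /= big1 ?add0r.
  rewrite subSn // subnn big_nat1 (_ : 4 * 1%:Z - 3 = 1) // expr1n mulr1 rmorphM /=.
  congr (_ * _); rewrite -pmulrn -bin_sub; last by lia.
  by congr ('C(_, _)%:R); lia.
(* For m < n the product has at least two factors, and the factor at j = 2 is 5. *)
move=> [m /= ltmn] _; rewrite 2!rmorphM /= rmorphXn /= rmorph_prod.
rewrite big_ltn; last by lia.
rewrite big_ltn /=; last by lia.
have -> : (4 * 2%:Z - 3)%:~R = 0 :> 'F_5 by apply/val_inj.
by rewrite mul0r mulr0 expr0n mulr0 mul0r.
Qed.

Lemma u_mod5 n : (u n)%:~R = (n <= 2)%:R :> 'F_5.
Proof.
elim: n => [|n IHn]; first by rewrite u0.
rewrite u_mod5S IHn rmorphXn rmorph_prod /=.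
(* u(3) vanishes by cancellation: the squared product is 1 modulo 5 and so is C(7,2) u(2). From u(4)
   on, the factor 15 at j = 4 kills the product and the previous value of u is already 0. *)
case: n {IHn} => [|[|[|n]]].
- by rewrite big_nat1; apply/eqP; vm_compute.
- by rewrite big_ltn // big_nat1; apply/eqP; vm_compute.
- by rewrite 2?big_ltn // big_nat1; apply/eqP; vm_compute.
rewrite mulr0 subr0 4?big_ltn //.
have -> : (4 * 4%:Z - 1)%:~R = 0 :> 'F_5 by apply/val_inj.
by rewrite mul0r !mulr0 expr0n.
Qed.

Lemma u_coef_mod5 i : (u_coef i)%:~R = (ind135 i)%:~R :> 'F_5.
Proof.
rewrite /u_coef /ind135 !inE; case: ifP => odd_i; last first.
  by case: eqP odd_i => [->|_] //; case: eqP => [->|_] //; case: eqP => [->|].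
by rewrite u_mod5 rmorph_nat; congr (nat_of_bool _)%:R; lia.
Qed.

Lemma s_bell n k : s n k = (bell u_coef (2 * k) (2 * n))%:~R.
Proof.
rewrite /s (@fps_exp_coef _ (2 * n).+1) //.
apply: (@bell_coef _ _ (2 * n).+1) => // i lti.
by rewrite coef_poly lti /u_egf /u_coef; case: ifP; rewrite ?mul0r.
Qed.

(** * Partitions into blocks of sizes 1, 3 and 5 *)

(* The number of partitions of a set of [d * c] elements into blocks of size d. *)
Definition block_count (d c : nat) : nat :=
  \prod_(i < c) 'C((d * i + d).-1, d.-1).

(** An ordering of all elements amounts to a partition, an order of its blocks and an order inside
    each block. *)
Lemma block_countE d c : (0 < d)%N ->
  ((d * c)`! = block_count d c * c`! * d`! ^ c)%N.
Proof.
move=> d_gt0; elim: c => [|c IHc]; first by rewrite muln0 /block_count big_ord0.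
case: d d_gt0 IHc => // d _ IHc.
rewrite /block_count big_ord_recr -/(block_count _ _) /= addnS /= mulnS addnC addnS.
rewrite factS factS expnS factS -(@bin_fact (d.+1 * c + d) d) ?leq_addl // addnK IHc.
by ring.
Qed.

Lemma coef_trinomial_exp (R : comNzRingType) (a b : R) (p q K N : nat) :
  (('X + a *: 'X^p + b *: 'X^q) ^+ K)`_N =
  \sum_(i < K.+1) \sum_(j < (K - i).+1)
    ((K - i - j + p * j + q * i)%N == N)%:R
      * ('C(K, i)%:R * 'C(K - i, j)%:R * a ^+ j * b ^+ i).
Proof.
rewrite exprDn coef_sum; apply: eq_bigr => i _.
rewrite exprDn mulr_suml -sumrMnl coef_sum; apply: eq_bigr => j _.
rewrite !exprZn -!exprM -!scalerAr -!scaler_nat -!scalerAl.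
rewrite !scalerA -!exprD coefZ coefXn eq_sym mulrC; congr (_ * _).
by ring.
Qed.

(** Here b and c count the blocks of sizes 3 and 5, the others being singletons. The formula comes
    from expanding the K-th power of z + z^3/3! + z^5/5! over the rationals. *)
Lemma bell_ind135 K N :
  bell ind135 K N =
  \sum_(b < K.+1) \sum_(c < (K - b).+1)
    ((K - b - c + 5 * c + 3 * b)%N == N)%:R *
    ('C(N, 3 * b) * 'C(N - 3 * b, 5 * c) * block_count 3 b * block_count 5 c)%:R.
Proof.
apply: (@intr_inj rat).
rewrite -(@bell_coef ind135 ('X + 120%:R^-1 *: 'X^5 + 6%:R^-1 *: 'X^3) N.+1) //.
  rewrite coef_trinomial_exp mulr_sumr rmorph_sum; apply: eq_bigr => -[b /= ltb] _.
  rewrite mulr_sumr rmorph_sum; apply: eq_bigr => -[c /= ltc] _.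
  rewrite rmorphM /= !rmorph_nat mulrCA.
  case: eqP => [NE|_]; last by rewrite !mul0r.
  congr (_ * _).
  have lebN : (3 * b <= N)%N by lia.
  have lecN : (5 * c <= N - 3 * b)%N by lia.
  have lebK : (b <= K)%N by lia.
  have lecK : (c <= K - b)%N by lia.
  have f3 : ((3 * b)`!)%:R = (block_count 3 b)%:R * (b`!)%:R * 6%:R ^+ b :> rat.
    by rewrite block_countE // 2!natrM natrX.
  have f5 : ((5 * c)`!)%:R = (block_count 5 c)%:R * (c`!)%:R * 120%:R ^+ c :> rat.
    by rewrite block_countE // 2!natrM natrX.
  have NcE : (N - 3 * b - 5 * c = K - b - c)%N by lia.
  have six_neq0 : 6%:R ^+ b != 0 :> rat by rewrite expf_neq0.
  have hundredtwenty_neq0 : 120%:R ^+ c != 0 :> rat by rewrite expf_neq0.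
  (* Once K! is factored through the binomials, its being nonzero provides every nonzero denominator
     that [field] asks for. *)
  move: (natf_fact_neq0 K).
  rewrite -(bin_fact lebN) -(bin_fact lecN) NcE -(bin_fact lebK) -(bin_fact lecK).
  rewrite (exprVn 6%:R) (exprVn 120%:R) !natrM f3 f5.
  move: six_neq0 hundredtwenty_neq0 {NE f3 f5}.
  move: (6%:R ^+ b : rat) (120%:R ^+ c : rat) => x y x_neq0 y_neq0.
  rewrite !mulf_eq0 !negb_or => /and5P[CK_neq0 b_neq0 CKb_neq0 c_neq0 a_neq0].
  field.
  by rewrite CK_neq0 b_neq0 CKb_neq0 c_neq0 a_neq0 x_neq0 y_neq0.
move=> i _; rewrite !coefD !coefZ coefX !coefXn /ind135 !inE.
do 3![case: eqP => [->|_] //].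
by rewrite !mulr0 mul0r.
Qed.

(** The factor at i = 1 is C(5,2) = 10. *)
Lemma block_count3_mod5 b : (block_count 3 b.+2)%:R = 0 :> 'F_5.
Proof.
rewrite /block_count 2!big_ord_recl mulnCA natrM.
have -> : ('C((3 * lift ord0 (@ord0 b) + 3).-1, 2))%:R = 0 :> 'F_5.
  by apply/eqP; vm_compute.
by rewrite mul0r.
Qed.

Lemma bell_u_coef_mod5 K N : (bell u_coef K.+1 N)%:~R =
    \sum_(c < K.+2)
      ((K.+1 - c + 5 * c)%N == N)%:R * ('C(N, 5 * c) * block_count 5 c)%:R
  + \sum_(c < K.+1) ((K - c + 5 * c + 3)%N == N)%:R
      * ('C(N, 3) * 'C(N - 3, 5 * c) * block_count 5 c)%:R :> 'F_5.
Proof.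
rewrite (bell_congr _ _ _ u_coef_mod5) bell_ind135 rmorph_sum 2!big_ord_recl /=.
rewrite [X in _ + (_ + X)]big1 ?addr0 => [|b _]; last first.
  rewrite rmorph_sum big1 // => c _ /=.
  by rewrite rmorphM /= !rmorph_nat 2!natrM block_count3_mod5 !(mulr0, mul0r).
rewrite !rmorph_sum; congr (_ + _); rewrite /bump ?subn0 ?subSS ?subn0.
  apply: eq_bigr => c _; rewrite rmorphM /= !rmorph_nat muln0 addn0 bin0 mul1n.
  by rewrite /block_count big_ord0 muln1.
apply: eq_bigr => c _; rewrite rmorphM /= !rmorph_nat muln1.
by rewrite /block_count big_ord_recl big_ord0 !muln1.
Qed.

(** * Selecting the surviving term *)

Lemma sum_delta (R : pzRingType) (I : finType) (f F : I -> nat) (N : nat) (i0 : I) :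
    (forall i, f i = N <-> i = i0) ->
  \sum_i (f i == N)%:R * (F i)%:R = (F i0)%:R :> R.
Proof.
move=> fE; rewrite (bigD1 i0) //= big1 => [|i ne_i].
  by rewrite addr0 (introT eqP (iffRL (fE _) erefl)) mul1r.
by case: eqP => [/fE iE|_]; [rewrite iE eqxx in ne_i | rewrite mul0r].
Qed.

Lemma sum_delta0 (R : pzRingType) (I : finType) (f F : I -> nat) (N : nat) :
    (forall i, f i <> N) ->
  \sum_i (f i == N)%:R * (F i)%:R = 0 :> R.
Proof. by move=> fN; rewrite big1 // => i _; case: eqP => [/fN|_] //; rewrite mul0r. Qed.

(** With 2k blocks, c' of them of size 5, the total size is 2k + 4c' for b = 0 and 2k + 2 + 4c' for
    b = 1; these differ modulo 4. *)
Lemma bell_mod5_even k c : (0 < k)%N -> (c <= 2 * k)%N ->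
  (bell u_coef (2 * k) (2 * (k + 2 * c)))%:~R
    = ('C(2 * (k + 2 * c), 5 * c) * block_count 5 c)%:R :> 'F_5.
Proof.
move=> k_gt0 lec; have [K KE] : {K | 2 * k = K.+1}%N by exists (2 * k).-1; lia.
rewrite KE bell_u_coef_mod5 [X in _ + X]sum_delta0 ?addr0 => [|[c' /=]]; last by lia.
have ltc : (c < K.+2)%N by lia.
rewrite (@sum_delta _ _ _ _ _ (Ordinal ltc)) // => -[c' ltc'] /=.
by split=> [?|[]]; [apply/val_inj => /= |]; lia.
Qed.

Lemma bell_mod5_odd k c : (0 < k)%N -> (c < 2 * k)%N ->
  (bell u_coef (2 * k) (2 * (k + 2 * c + 1)))%:~R
    = ('C(2 * (k + 2 * c + 1), 3) * 'C(2 * (k + 2 * c + 1) - 3, 5 * c)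
        * block_count 5 c)%:R :> 'F_5.
Proof.
move=> k_gt0 ltck; have [K KE] : {K | 2 * k = K.+1}%N by exists (2 * k).-1; lia.
rewrite KE bell_u_coef_mod5 [X in X + _]sum_delta0 ?add0r => [|[c' /=]]; last by lia.
have ltc : (c < K.+1)%N by lia.
rewrite (@sum_delta _ _ _ _ _ (Ordinal ltc)) // => -[c' ltc'] /=.
by split=> [?|[]]; [apply/val_inj => /= |]; lia.
Qed.

(** 2k blocks of size at most 5 cover at most 10k < 2n elements. *)
Lemma bell_mod5_large k n : (0 < k)%N -> (5 * k < n)%N ->
  (bell u_coef (2 * k) (2 * n))%:~R = 0 :> 'F_5.
Proof.
move=> k_gt0 ltn; have [K KE] : {K | 2 * k = K.+1}%N by exists (2 * k).-1; lia.
by rewrite KE bell_u_coef_mod5 !sum_delta0 ?addr0 // => -[c' /=]; lia.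
Qed.

(** Since 5! = 5 * 24, dividing by 5^c instead of (5!)^c leaves the factor 24^c; this also shows
    that the quotient is an integer. *)
Lemma fact_blocks5 a c : ((a + 5 * c)`!)%:R / ((a`!)%:R * (c`!)%:R * 5 ^+ c)
  = (24 ^ c * 'C(a + 5 * c, 5 * c) * block_count 5 c)%:R :> rat.
Proof.
have le5c : (5 * c <= a + 5 * c)%N by rewrite leq_addl.
have f5 : ((5 * c)`!)%:R
    = (block_count 5 c)%:R * (c`!)%:R * (5 ^+ c * 24 ^+ c) :> rat.
  by rewrite block_countE // 2!natrM natrX -exprMn -natrM.
have pow5_neq0 : 5%:R ^+ c != 0 :> rat by rewrite expf_neq0.
have := (natf_fact_neq0 a, natf_fact_neq0 c).
rewrite -(bin_fact le5c) addnK !natrM f5 natrX => -[a_neq0 c_neq0] {f5}.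
move: pow5_neq0; move: (5%:R ^+ c : rat) (24%:R ^+ c : rat) => x y x_neq0.
by field; rewrite a_neq0 c_neq0 x_neq0.
Qed.

Theorem theorem10 (n k : nat) (hk : (1 <= k)%N) :
  [/\ (k <= n <= 5 * k)%N -> ~~ odd (n - k) ->
        int_congr 5 (r n k)
          (((2 * n)`!)%:R
             / ((((5 * k - n)./2)`!)%:R * (((n - k)./2)`!)%:R
                * 5 ^+ (n - k)./2)),
      (k <= n <= 5 * k)%N -> odd (n - k) ->
        int_congr 5 (r n k)
          (2 * ((2 * n)`!)%:R
             / ((((5 * k - n - 1)./2)`!)%:R * (((n - k - 1)./2)`!)%:R
                * 5 ^+ (n - k - 1)./2))
    & (5 * k < n)%N -> int_congr 5 (r n k) 0].
Proof.
have rE : r n k = (2 ^+ (n - k) * bell u_coef (2 * k) (2 * n))%:~R.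
  by rewrite /r s_bell rmorphM rmorphXn.
(* The power of 2 in [r] matches the 24^c of [fact_blocks5], as 4 and 24 agree modulo 5. *)
have pow4 c : 2 ^+ (2 * c) = 24 ^+ c :> 'F_5.
  by rewrite exprM; congr (_ ^+ c); apply/eqP; vm_compute.
split=> [/andP[lekn len5k] even_nk|/andP[lekn len5k] odd_nk|lt5kn].
- have [c nE] : {c | n = k + 2 * c}%N by exists (n - k)./2; lia.
  exists (2 ^+ (n - k) * bell u_coef (2 * k) (2 * n)).
  exists (24 ^ c * 'C(2 * n, 5 * c) * block_count 5 c)%N%:Z.
  have -> : ((n - k)./2 = c)%N by lia.
  have aE : (2 * n = (5 * k - n)./2 + 5 * c)%N by lia.
  split=> //; first by rewrite {1}aE fact_blocks5 -aE -pmulrn.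
  apply: eqz_mod5; rewrite rmorphM rmorphXn /= nE bell_mod5_even //; last by lia.
  by rewrite addKn pow4 -pmulrn !natrM natrX mulrA.
- have [c nE] : {c | n = k + 2 * c + 1}%N by exists (n - k)./2; lia.
  exists (2 ^+ (n - k) * bell u_coef (2 * k) (2 * n)).
  (* 12 = 2 * 3!, from the leading 2 and from (2n)! = C(2n,3) 3! (2n-3)!. Modulo 5 it is 2, the
     extra factor in 2^(2c+1). *)
  exists (12 * 'C(2 * n, 3) * (24 ^ c * 'C(2 * n - 3, 5 * c) * block_count 5 c))%N%:Z.
  have -> : ((n - k - 1)./2 = c)%N by lia.
  have aE : (2 * n - 3 = (5 * k - n - 1)./2 + 5 * c)%N by lia.
  have le3 : (3 <= 2 * n)%N by lia.
  split=> //.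
    rewrite -(bin_fact le3) -pmulrn [in RHS]natrM {2}aE -fact_blocks5 -aE.
    rewrite (mulnA 'C(_, _)) natrM [in LHS]natrM [in RHS]natrM.
    rewrite (_ : 12%:R = 2 * (3`!)%:R :> rat) //.
    by rewrite !mulrA; congr (_ / _); ring.
  apply: eqz_mod5; rewrite rmorphM rmorphXn /= nE bell_mod5_odd //; last by lia.
  have -> : (k + 2 * c + 1 - k = (2 * c).+1)%N by lia.
  rewrite exprS pow4 -pmulrn !natrM natrX (_ : 12%:R = 2 :> 'F_5).
    by ring.
  by apply/eqP; vm_compute.
exists (2 ^+ (n - k) * bell u_coef (2 * k) (2 * n)), 0; split=> //.
by apply: eqz_mod5; rewrite rmorphM /= bell_mod5_large // mulr0.
Qed.
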